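(* For every group $H$ there are a group $G$ containing $H$ as a subgroup (up to isomorphism) and a set $Y$ such that $G$ acts sharply $2$-transitively on $Y$ and $G$ has no nontrivial abelian normal subgroup.
   Context: An action of a group $G$ on a set $Y$ with at least two elements is sharply $2$-transitive if for all pairs $(x,y),(x',y')\in Y^2$ with $x\neq y$ and $x'\neq y'$ there is exactly one $g\in G$ with $xg=x'$ and $yg=y'$. *)

(* Defs.v *)
From HB Require Import structures.
From mathcomp Require Import all_boot.
From mathcomp Require Import boolp classical_sets.

Set Implicit Arguments.
Unset Strict Implicit.
Unset Printing Implicit Defensive.

Local Open Scope classical_set_scope.
Local Open Scope group_scope.

(* [is_action] and [action] of the finite group library require a finite
   acting group, hence this version for an arbitrary [groupType]. *)
Record right_action (G : groupType) (Y : Type) := RightAction {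
  ract :> Y -> G -> Y;
  ract1 : forall y, ract y 1 = y;
  ractM : forall y g h, ract y (g * h) = ract (ract y g) h
}.

Definition sharply_2_transitive (G : groupType) (Y : Type)
    (to : right_action G Y) : Prop :=
  (exists y z : Y, y <> z) /\
  forall x y x' y' : Y, x <> y -> x' <> y' ->
    exists! g : G, to x g = x' /\ to y g = y'.

(* Subgroups of a possibly infinite group are arbitrary [Prop]-valued subsets;
   [[in N]] is the classical boolean membership predicate of [N]. *)
Definition is_subgroup (G : groupType) (N : set G) : Prop :=
  group_closed [in N].

Definition is_normal_subgroup (G : groupType) (N : set G) : Prop :=
  is_subgroup N /\ forall x g : G, N x -> N (x ^ g).

Definition is_abelian (G : groupType) (N : set G) : Prop :=
  forall x y : G, N x -> N y -> commute x y.

(* Main.v *)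
Require Import Defs.
From HB Require Import structures.
From Stdlib Require Eqdep_dec.
From mathcomp Require Import all_boot fingroup perm.
From mathcomp Require Import boolp classical_sets.

(** Consider actions in which a nontrivial element fixes at most one point and
    an involution fixes none, with a base point x0 and an involution t; the
    regular action of H * S_3 is one.  Choose representatives (a, b) of the
    orbits of unordered pairs of points other than the orbit of {x0, x0 t}, and
    adjoin for each of them a stable letter f with a f = x0 and b f = x0 t,
    subject to f^-1 i f = t if an involution i swaps a and b (an HNN
    extension).  The action extends freely to the larger group.  A path from a
    fixed point of a cyclically reduced word never enters the free part, so two
    fixed points would give a path of pairs in the original set; since f is
    followed by some f'^-1, and f^-1 by f itself with the connecting element
    stabilising {a, b}, such a path is not reduced.  Hence both fixed-point
    properties persist, and iterating countably often yields a sharply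
    2-transitive action.  There a nontrivial abelian normal subgroup would be
    regular and contain all involutions, but those of S_3 do not commute. *)

Set Implicit Arguments.
Unset Strict Implicit.
Unset Printing Implicit Defensive.

Local Open Scope classical_set_scope.
Local Open Scope group_scope.

(** Related points have equal predicates [R x] by extensionality, and [cid] applied to equal
    predicates, with irrelevant proofs, chooses the same witness. *)
Lemma equivalence_rep (T : Type) (R : T -> T -> Prop) :
  (forall x, R x x) -> (forall x y, R x y -> R y x) ->
  (forall x y z, R x y -> R y z -> R x z) ->
  exists rep : T -> T,
    (forall x, R x (rep x)) /\ forall x y, R x y -> rep x = rep y.
Proof.
move=> Rxx Rsym Rtr; pose ne x : exists y, R x y := ex_intro _ x (Rxx x).
exists (fun x => sval (cid (ne x))); split=> [x|x y Rxy]; first by case: cid.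
have RE : R x = R y.
  by apply/funext => z; apply/propext; split=> [|/(Rtr _ _ _ Rxy)//];
     apply/Rtr/Rsym.
by move: (ne x) (ne y); rewrite RE => h1 h2; rewrite (Prop_irrelevance h1 h2).
Qed.

(** * Groups of permutations *)

(** The groups of the extension step and of the limit are both realised in this way, so that two
    elements are equal as soon as they act equally. The order [g \o f] is that of a right action. *)
Record perm_group (X : Type) := PermGroup {
  perm_set :> set (X -> X);
  perm_set1 : perm_set id;
  perm_setM : forall f g, perm_set f -> perm_set g -> perm_set (g \o f);
  perm_setV : forall f, perm_set f ->
    exists2 g, perm_set g & cancel f g /\ cancel g f
}.

Section PermGroup.
Variables (X : Type) (P : perm_group X).

Definition perm_elt : Type := {f : X -> X | perm_set P f}.

Lemma perm_elt_inj (a b : perm_elt) : sval a =1 sval b -> a = b.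
Proof. by case: a b => [f Pf] [g Pg] /= /funext fg; apply: eq_exist. Qed.

Definition perm_elt_mul (a b : perm_elt) : perm_elt :=
  exist _ (sval b \o sval a) (perm_setM (svalP a) (svalP b)).

Definition perm_elt_one : perm_elt := exist _ id (perm_set1 P).

Lemma perm_elt_inv_subproof (a : perm_elt) :
  {b : perm_elt | cancel (sval a) (sval b) /\ cancel (sval b) (sval a)}.
Proof.
by apply: cid; have [g Pg gK] := perm_setV (svalP a); exists (exist _ g Pg).
Qed.

Definition perm_elt_inv (a : perm_elt) : perm_elt :=
  sval (perm_elt_inv_subproof a).

HB.instance Definition _ := gen_eqMixin perm_elt.
HB.instance Definition _ := gen_choiceMixin perm_elt.

Lemma perm_elt_mulA : associative perm_elt_mul.
Proof. by move=> a b c; apply: perm_elt_inj. Qed.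

Lemma perm_elt_mul1 : left_id perm_elt_one perm_elt_mul.
Proof. by move=> a; apply: perm_elt_inj. Qed.

Lemma perm_elt_mulr1 : right_id perm_elt_one perm_elt_mul.
Proof. by move=> a; apply: perm_elt_inj. Qed.

Lemma perm_elt_mulV : left_inverse perm_elt_one perm_elt_inv perm_elt_mul.
Proof.
move=> a; apply: perm_elt_inj => x /=; rewrite /perm_elt_inv.
by case: perm_elt_inv_subproof => b [/= _ ->].
Qed.

Lemma perm_elt_mulrV : right_inverse perm_elt_one perm_elt_inv perm_elt_mul.
Proof.
move=> a; apply: perm_elt_inj => x /=; rewrite /perm_elt_inv.
by case: perm_elt_inv_subproof => b [/= -> _].
Qed.

HB.instance Definition _ := isGroup.Build perm_elt perm_elt_mulA perm_elt_mul1
  perm_elt_mulr1 perm_elt_mulV perm_elt_mulrV.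

Definition perm_action : right_action perm_elt X :=
  @RightAction perm_elt X (fun x a => sval a x)
               (fun=> erefl) (fun _ _ _ => erefl).

Lemma perm_actionP (f : X -> X) :
  perm_set P f -> exists a : perm_elt, perm_action^~ a = f.
Proof. by move=> Pf; exists (exist _ f Pf). Qed.

End PermGroup.

(** * Right actions *)

Section ActionTheory.
Variables (G : groupType) (X : Type) (to : right_action G X).

Lemma ractK g : cancel (to^~ g) (to^~ g^-1).
Proof. by move=> x; rewrite -ractM mulgV ract1. Qed.

Lemma ractVK g : cancel (to^~ g^-1) (to^~ g).
Proof. by move=> x; rewrite -ractM mulVg ract1. Qed.

Lemma ract_inj x y g : to x g = to y g -> x = y.
Proof. exact: can_inj (ractK g) _ _. Qed.

End ActionTheory.

(** * Adjoining stable letters to an action *)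

(* The letter [l] acts as the partial map [f l] with domain [D l], and
   conjugates the subgroup [C l] to [C (inv l)] by the isomorphism [phi l]. *)
Section StableLetters.
Variables (G : groupType) (X : Type) (to : right_action G X).
Variables (L : Type) (inv : L -> L).
Variables (C : L -> set G) (phi : L -> G -> G).
Variables (D : L -> set X) (f : L -> X -> X).
Variable l0 : L.

Hypothesis invK : involutive inv.
Hypothesis inv_neq : forall l, inv l <> l.
Hypothesis C1 : forall l, C l 1.
Hypothesis CM : forall l c d, C l c -> C l d -> C l (c * d).
Hypothesis CV : forall l c, C l c -> C l c^-1.
Hypothesis phiC : forall l c, C l c -> C (inv l) (phi l c).
Hypothesis phiK : forall l c, C l c -> phi (inv l) (phi l c) = c.
Hypothesis phiM : forall l c d, C l c -> C l d ->
  phi l (c * d) = phi l c * phi l d.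
Hypothesis DC : forall l x c, C l c -> D l x -> D l (to x c).
Hypothesis fD : forall l x, D l x -> D (inv l) (f l x).
Hypothesis fK : forall l x, D l x -> f (inv l) (f l x) = x.
Hypothesis fC : forall l x c, C l c -> D l x ->
  f l (to x c) = to (f l x) (phi l c).
Hypothesis C_free : forall l x c, C l c -> ~ D l x -> to x c = x -> c = 1.

(** [Ext q l g] stands for the point q l g reached by leaving q through [l]; each exit opens a fresh
    copy of [G], on which [G] acts regularly. *)
Inductive pre_point :=
| Base of X
| Ext of pre_point & L & G.

Definition pre_act (p : pre_point) (g : G) : pre_point :=
  match p with
  | Base x => Base (to x g)
  | Ext q l h => Ext q l (h * g)
  end.

(** On the free part this is the cancellation condition of Britton's lemma: k g l collapses to an
    element of the associated subgroup. *)
Definition pre_dom (l : L) (p : pre_point) : Prop :=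
  match p with
  | Base x => D l x
  | Ext _ k g => l = inv k /\ C l g
  end.

Lemma pre_act1 p : pre_act p 1 = p.
Proof. by case: p => [x|q l g] /=; rewrite ?ract1 ?mulg1. Qed.

Lemma pre_actM p g h : pre_act p (g * h) = pre_act (pre_act p g) h.
Proof. by case: p => [x|q l k] /=; rewrite ?ractM ?mulgA. Qed.

Lemma pre_domC l p c : C l c -> pre_dom l (pre_act p c) <-> pre_dom l p.
Proof.
move=> Cc; have sub q d : C l d -> pre_dom l q -> pre_dom l (pre_act q d).
  case: q => [x|q k g] /= Cd; first exact: DC.
  by case=> ? ?; split=> //; apply: CM.
split; last exact: sub.
by move=> /(sub _ _ (CV Cc)); rewrite -pre_actM mulgV pre_act1.
Qed.

Lemma pre_free l p c : C l c -> ~ pre_dom l p -> pre_act p c = p -> c = 1.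
Proof.
case: p => [x|q k g] /= Cc nD; first by case; apply: C_free nD.
by case=> /(canRL (mulKg g)); rewrite mulVg.
Qed.

Definition pre_orbit (l : L) (p q : pre_point) : Prop :=
  exists2 c, C l c & q = pre_act p c.

Lemma pre_orbit_refl l p : pre_orbit l p p.
Proof. by exists 1; rewrite ?pre_act1 //; apply: C1. Qed.

Lemma pre_orbit_sym l p q : pre_orbit l p q -> pre_orbit l q p.
Proof.
case=> c Cc ->; exists c^-1; first exact: CV.
by rewrite -pre_actM mulgV pre_act1.
Qed.

Lemma pre_orbit_trans l p q r :
  pre_orbit l p q -> pre_orbit l q r -> pre_orbit l p r.
Proof.
move=> [c Cc ->] [d Cd ->]; exists (c * d); first exact: CM.
by rewrite pre_actM.
Qed.

Definition pre_rep (l : L) : pre_point -> pre_point :=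
  sval (cid (equivalence_rep (pre_orbit_refl l) (@pre_orbit_sym l)
                             (@pre_orbit_trans l))).

Lemma pre_repP l p : pre_orbit l p (pre_rep l p).
Proof. by rewrite /pre_rep; case: cid => r [rP ?] /=; apply: rP. Qed.

Lemma pre_repC l p c : C l c -> pre_rep l (pre_act p c) = pre_rep l p.
Proof.
move=> Cc; rewrite /pre_rep; case: cid => r [? rE] /=; symmetry; apply: rE.
by exists c.
Qed.

Lemma pre_shift_subproof l p : exists c, C l c /\ p = pre_act (pre_rep l p) c.
Proof. by have [c Cc e] := pre_orbit_sym (pre_repP l p); exists c. Qed.

Definition pre_shift (l : L) (p : pre_point) : G :=
  sval (cid (pre_shift_subproof l p)).

Lemma pre_shiftC l p : C l (pre_shift l p).
Proof. by rewrite /pre_shift; case: cid => c []. Qed.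

Lemma pre_shiftE l p : p = pre_act (pre_rep l p) (pre_shift l p).
Proof. by rewrite /pre_shift; case: cid => c []. Qed.

(** Off the domain [C l] acts freely, so the element carrying the representative to a given point of
    its orbit is unique. *)
Lemma pre_shiftP l p c : C l c -> ~ pre_dom l p ->
  pre_shift l (pre_act p c) = pre_shift l p * c.
Proof.
move=> Cc nD; set q := pre_rep l p.
have nDq : ~ pre_dom l q.
  by rewrite -(pre_domC q (pre_shiftC l p)) -pre_shiftE.
have := pre_shiftE l (pre_act p c).
rewrite pre_repC // -/q {1}(pre_shiftE l p) -/q -pre_actM.
set d := pre_shift l p * c; set e := pre_shift _ _ => de.
have Cd : C l d by apply: CM => //; apply: pre_shiftC.
have Ce : C l e by apply: pre_shiftC.
suff /(canRL (mulgVK _)) : d / e = 1 by rewrite mul1g.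
apply: (@pre_free l q) => //; first by apply: CM => //; apply: CV.
by rewrite pre_actM de -pre_actM mulgV pre_act1.
Qed.

(* A path entering a free region through [l] is recorded by [Ext]; its first
   vertex is normalised to the chosen representative of its [C l]-orbit. *)
Fixpoint pre_valid (p : pre_point) : Prop :=
  match p with
  | Base _ => True
  | Ext q l _ => [/\ pre_valid q, ~ pre_dom l q & pre_shift l q = 1]
  end.

(** Off the domain, p is its representative moved by some c in [C l], and the relation c l = l
    phi(c) then dictates the value. *)
Definition pre_letter (l : L) (p : pre_point) : pre_point :=
  if pselect (pre_dom l p) then
    match p with
    | Base x => Base (f l x)
    | Ext q k g => pre_act q (phi l g)
    end
  else Ext (pre_rep l p) l (phi l (pre_shift l p)).

Lemma pre_valid_act p g : pre_valid p -> pre_valid (pre_act p g).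
Proof. by case: p. Qed.

Lemma pre_valid_rep l p : pre_valid p -> pre_valid (pre_rep l p).
Proof.
move=> vp; rewrite -(pre_act1 (pre_rep l p)) -(mulgV (pre_shift l p)).
by rewrite pre_actM -pre_shiftE; apply: pre_valid_act.
Qed.

Lemma pre_dom_rep l p : pre_dom l (pre_rep l p) <-> pre_dom l p.
Proof. by rewrite -(pre_domC _ (pre_shiftC l p)) -pre_shiftE. Qed.

Lemma pre_shift_rep l p : ~ pre_dom l p -> pre_shift l (pre_rep l p) = 1.
Proof.
move=> nD; have nDr : ~ pre_dom l (pre_rep l p) by rewrite pre_dom_rep.
have := pre_shiftP (pre_shiftC l p) nDr; rewrite -pre_shiftE.
by move=> e; apply: (mulIg (pre_shift l p)); rewrite mul1g -e.
Qed.

Lemma pre_letter_base l x : D l x -> pre_letter l (Base x) = Base (f l x).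
Proof. by rewrite /pre_letter; case: pselect. Qed.

Lemma pre_letter_back l q g : C (inv l) g ->
  pre_letter (inv l) (Ext q l g) = pre_act q (phi (inv l) g).
Proof. by rewrite /pre_letter; case: pselect => // nD Cg; case: nD. Qed.

Lemma pre_letter_out l p : ~ pre_dom l p ->
  pre_letter l p = Ext (pre_rep l p) l (phi l (pre_shift l p)).
Proof. by rewrite /pre_letter; case: pselect. Qed.

Lemma pre_valid_letter l p : pre_valid p -> pre_valid (pre_letter l p).
Proof.
rewrite /pre_letter; case: pselect => [Dp|nD] vp.
  by case: p Dp vp => //= q k g _ [vq _ _]; apply: pre_valid_act.
split; first exact: pre_valid_rep.
  by rewrite pre_dom_rep.
exact: pre_shift_rep.
Qed.

Lemma pre_rep_valid l p : pre_shift l p = 1 -> pre_rep l p = p.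
Proof. by move=> p1; rewrite {2}(pre_shiftE l p) p1 pre_act1. Qed.

(** A fresh exit is cancelled at once by the inverse letter. Conversely, undoing a cancellation
    restores [Ext q k g] itself because validity makes q the representative of its orbit. *)
Lemma pre_letterK l p :
  pre_valid p -> pre_letter (inv l) (pre_letter l p) = p.
Proof.
move=> vp; have [Dp|nD] := pselect (pre_dom l p); last first.
  rewrite (pre_letter_out nD) pre_letter_back ?phiK -?pre_shiftE //.
    exact: pre_shiftC.
  exact/phiC/pre_shiftC.
case: p Dp vp => [x|q k g] Dp.
  by rewrite !pre_letter_base ?fK //; apply: fD.
case: Dp => lk Cg [vq nDq q1]; have ik : k = inv l by rewrite lk invK.
rewrite ik in nDq q1 *; have Cp := phiC Cg.
rewrite -{2}(invK l) pre_letter_back ?invK //.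
rewrite pre_letter_out ?pre_domC // pre_repC // (pre_rep_valid q1).
by rewrite pre_shiftP // q1 mul1g phiK.
Qed.

(** This is the defining relation c l = l phi(c) of an HNN extension. *)
Lemma pre_letterC l p c : C l c ->
  pre_letter l (pre_act p c) = pre_act (pre_letter l p) (phi l c).
Proof.
move=> Cc; have [Dp|nD] := pselect (pre_dom l p); last first.
  rewrite !pre_letter_out ?pre_domC // pre_repC // pre_shiftP // phiM //.
  exact: pre_shiftC.
case: p Dp => [x|q k g] /= Dp.
  by rewrite !pre_letter_base ?fC //; apply: DC.
case: Dp => lk Cg; rewrite lk in Cc Cg *.
by rewrite !pre_letter_back ?phiM ?pre_actM //; apply: CM.
Qed.

Definition point : Type := {p : pre_point | pre_valid p}.

Lemma point_inj (p q : point) : sval p = sval q -> p = q.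
Proof. by case: p q => [p vp] [q vq] /= pq; apply: eq_exist. Qed.

Definition point_of (x : X) : point := exist _ (Base x) I.

Definition point_act (p : point) (g : G) : point :=
  exist _ (pre_act (sval p) g) (pre_valid_act g (svalP p)).

Definition point_letter (l : L) (p : point) : point :=
  exist _ (pre_letter l (sval p)) (pre_valid_letter l (svalP p)).

Lemma point_act1 p : point_act p 1 = p.
Proof. by apply: point_inj => /=; rewrite pre_act1. Qed.

Lemma point_actM p g h : point_act p (g * h) = point_act (point_act p g) h.
Proof. by apply: point_inj => /=; rewrite pre_actM. Qed.

Lemma point_letterK l : cancel (point_letter l) (point_letter (inv l)).
Proof. by move=> p; apply/point_inj/pre_letterK/svalP. Qed.

Lemma point_letterC l p c : C l c ->
  point_letter l (point_act p c) = point_act (point_letter l p) (phi l c).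
Proof. by move=> Cc; apply/point_inj/pre_letterC. Qed.

Lemma point_of_letter l x :
  D l x -> point_letter l (point_of x) = point_of (f l x).
Proof.
by move=> Dx; apply: point_inj; rewrite /= pre_letter_base.
Qed.

Hypothesis free2 : forall x y g, x <> y -> to x g = x -> to y g = y -> g = 1.
Hypothesis inv_free : forall x g, g * g = 1 -> to x g = x -> g = 1.

(* The word [g_0 l_0 g_1 l_1 ...] is encoded as a sequence of pairs, a cyclic
   word of length [m] as an [m]-periodic one. *)
Definition reduced (s : nat -> G * L) : Prop := forall k,
  ~ ((s k.+1).2 = inv (s k).2 /\ C (s k.+1).2 (s k.+1).1).

Hypothesis reduced_fix : forall (s : nat -> G * L) (x y : nat -> X),
  reduced s ->
  (forall k, D (s k).2 (to (x k) (s k).1) /\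
             x k.+1 = f (s k).2 (to (x k) (s k).1)) ->
  (forall k, D (s k).2 (to (y k) (s k).1) /\
             y k.+1 = f (s k).2 (to (y k) (s k).1)) ->
  x 0%N = y 0%N.

(** * Closed paths of reduced words *)

Fixpoint path (s : nat -> G * L) (p : point) (n : nat) : point :=
  if n is m.+1 then point_letter (s m).2 (point_act (path s p m) (s m).1)
  else p.

Lemma path_add s p k m :
  path s p (k + m) = path (fun i => s (k + i)%N) (path s p k) m.
Proof. by elim: m => [|m IHm]; rewrite ?addn0 // addnS /= IHm. Qed.

Lemma eq_path s s' p n :
  (forall k, (k < n)%N -> s k = s' k) -> path s p n = path s' p n.
Proof.
elim: n => // n IHn ss' /=; rewrite ss' // IHn // => k kn.
by apply: ss'; apply: ltnW.
Qed.

Fixpoint height (p : pre_point) : nat :=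
  if p is Ext q _ _ then (height q).+1 else 0.

Lemma height_act p g : height (pre_act p g) = height p.
Proof. by case: p. Qed.

Lemma height_rep l p : height (pre_rep l p) = height p.
Proof. by rewrite {2}(pre_shiftE l p) height_act. Qed.

(** If the next letter were applicable at the new vertex, dividing by the image of the shift, which
    lies in [C], would put the next group element in [C] as well: a cancellation that [reduced]
    forbids. *)
Lemma path_out s p k : reduced s ->
  ~ pre_dom (s k).2 (sval (point_act (path s p k) (s k).1)) ->
  ~ pre_dom (s k.+1).2 (sval (point_act (path s p k.+1) (s k.+1).1)) /\
  height (sval (path s p k.+1)) = (height (sval (path s p k))).+1.
Proof.
move=> rs nD /=; rewrite pre_letter_out //= height_rep height_act; split=> //.
set q := pre_act _ _ in nD *; set c := pre_shift _ _ => -[e Cc].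
apply: (rs k); split=> //.
have Cphi : C (s k.+1).2 (phi (s k).2 c) by rewrite e; apply/phiC/pre_shiftC.
by rewrite -(mulKg (phi (s k).2 c) (s k.+1).1); apply: CM => //; apply: CV.
Qed.

(* Once a reduced path leaves the domain of its letters, it climbs forever. *)
Lemma path_periodic_dom s p m k : reduced s -> (0 < m)%N ->
  (forall i, path s p (i + m) = path s p i) ->
  pre_dom (s k).2 (sval (point_act (path s p k) (s k).1)).
Proof.
move=> rs m_gt0 per; apply: contrapT => nD.
have climb i :
    ~ pre_dom (s (k + i)).2
        (sval (point_act (path s p (k + i)) (s (k + i)%N).1)) /\
    height (sval (path s p (k + i))) = (height (sval (path s p k)) + i)%N.
  elim: i => [|i [nDi hi]]; first by rewrite !addn0.
  by rewrite !addnS -hi; apply: path_out.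
have [_] := climb m; rewrite per => /eqP.
by rewrite -{1}[height _]addn0 eqn_add2l eq_sym -leqn0 leqNgt m_gt0.
Qed.

Lemma height_letter l p :
  pre_dom l p -> (height (pre_letter l p) <= height p)%N.
Proof.
case: p => [x|q k g] Dp; first by rewrite pre_letter_base.
case: Dp => lk Cg; rewrite lk in Cg *.
by rewrite pre_letter_back // height_act /= leqnSn.
Qed.

(** Along a periodic path every letter is applicable, so the height never increases and hence is
    constant; on the free part an applicable letter would lower it. *)
Lemma path_periodic_base s p m k : reduced s -> (0 < m)%N ->
  (forall i, path s p (i + m) = path s p i) ->
  exists2 x, path s p k = point_of x & D (s k).2 (to x (s k).1).
Proof.
move=> rs m_gt0 per.
have Dp i := path_periodic_dom i rs m_gt0 per.
have noninc i : (height (sval (path s p i.+1)) <= height (sval (path s p i)))%N.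
  by rewrite (leq_trans (height_letter (Dp i))) // height_act.
have nonincD i j :
    (height (sval (path s p (i + j))) <= height (sval (path s p i)))%N.
  by elim: j => [|j IHj]; rewrite ?addn0 // addnS (leq_trans _ IHj).
(* Following the path from k + 1 to k + m bounds the height at k by the height at k + 1. *)
have := Dp k; have := nonincD k.+1 m.-1; rewrite addSnnS prednK // per /=.
case: (path s p k) => -[x|q l g] vq /=.
  by exists x => //; apply: point_inj.
move=> hle [e Cg]; rewrite e in Cg; move: hle.
by rewrite e pre_letter_back // height_act ltnn.
Qed.

Lemma path_periodic s p m :
  (forall k, s (m + k)%N = s k) -> path s p m = p ->
  forall i, path s p (i + m) = path s p i.
Proof.
by move=> sm pm i; rewrite addnC path_add pm; apply: eq_path => k _; apply: sm.
Qed.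

Lemma reduced_path_fix s p q m : reduced s -> (0 < m)%N ->
  (forall k, s (m + k)%N = s k) -> path s p m = p -> path s q m = q -> p = q.
Proof.
move=> rs m_gt0 sm pm qm.
have base r : path s r m = r -> exists x : nat -> X, forall k,
    path s r k = point_of (x k) /\ D (s k).2 (to (x k) (s k).1).
  move=> rm; have /choice[x xP] : forall k, exists x,
      path s r k = point_of x /\ D (s k).2 (to x (s k).1); last by exists x.
  move=> k; have [x] := path_periodic_base k rs m_gt0 (path_periodic sm rm).
  by exists x.
have walk r x : (forall k, path s r k = point_of (x k) /\
      D (s k).2 (to (x k) (s k).1)) ->
    forall k, D (s k).2 (to (x k) (s k).1) /\
              x k.+1 = f (s k).2 (to (x k) (s k).1).
  move=> xP k; have [e Dk] := xP k; split=> //.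
  have [] := xP k.+1; rewrite /= e => /(congr1 sval) /=.
  by rewrite pre_letter_base // => -[].
have [[x xP] [y yP]] := (base p pm, base q qm).
have [/= -> _] := xP 0%N; have [/= -> _] := yP 0%N.
by rewrite (reduced_fix rs (walk _ _ xP) (walk _ _ yP)).
Qed.

(** * The group generated by [G] and the letters *)

Inductive word_map : (point -> point) -> Prop :=
| word_map_id : word_map id
| word_map_act F g : word_map F -> word_map (fun p => point_act (F p) g)
| word_map_letter F l : word_map F -> word_map (fun p => point_letter l (F p)).

Lemma word_map_comp F F' : word_map F -> word_map F' -> word_map (F' \o F).
Proof.
move=> wF; elim=> // F'' a _ IH; first exact: (word_map_act a IH).
exact: (word_map_letter a IH).
Qed.

Lemma point_actK g : cancel (point_act^~ g) (point_act^~ g^-1).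
Proof. by move=> p; rewrite -point_actM mulgV point_act1. Qed.

Lemma point_actVK g : cancel (point_act^~ g^-1) (point_act^~ g).
Proof. by move=> p; rewrite -point_actM mulVg point_act1. Qed.

Lemma point_letterVK l : cancel (point_letter (inv l)) (point_letter l).
Proof. by move=> p; rewrite -{1}(invK l) point_letterK. Qed.

Lemma word_map_inv F : word_map F ->
  exists2 F', word_map F' & cancel F F' /\ cancel F' F.
Proof.
elim=> [|{}F g wF [F' wF' [FK FK']]|{}F l wF [F' wF' [FK FK']]].
- by exists id => //; exact: word_map_id.
- exists (F' \o point_act^~ g^-1).
    exact: word_map_comp (word_map_act _ word_map_id) wF'.
  by split=> p /=; [rewrite point_actK FK | rewrite FK' point_actVK].
exists (F' \o point_letter (inv l)).
  exact: word_map_comp (word_map_letter _ word_map_id) wF'.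
by split=> p /=; [rewrite point_letterK FK | rewrite FK' point_letterVK].
Qed.

Definition word_group : perm_group point :=
  PermGroup word_map_id word_map_comp word_map_inv.

Lemma word_map_path F : word_map F ->
  exists n s g, F = fun p => point_act (path s p n) g.
Proof.
elim=> [|{}F g _ [n [s [h ->]]]|{}F l _ [n [s [h ->]]]].
(* The empty path reads no pair; [l0] merely fills the sequence. *)
- by exists 0%N, (fun=> (1, l0)), 1; apply/funext => p; rewrite point_act1.
- by exists n, s, (h * g); apply/funext => p; rewrite point_actM.
exists n.+1, (fun k => if k == n then (h, l) else s k), 1.
apply/funext => p; rewrite point_act1 /= eqxx /=.
congr (point_letter _ (point_act _ _)).
by apply: eq_path => k kn; rewrite ltn_eqF.
Qed.

(** Any bijection may serve as conjugator, since only fixed points and triviality are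
    transported. *)
Definition conjugate_map (F F' : point -> point) : Prop :=
  exists2 h : point -> point, bijective h & forall p, h (F p) = F' (h p).

Lemma conjugate_map_trans F1 F2 F3 :
  conjugate_map F1 F2 -> conjugate_map F2 F3 -> conjugate_map F1 F3.
Proof.
move=> [h hb hE] [k kb kE]; exists (k \o h); first exact: bij_comp.
by move=> p /=; rewrite hE kE.
Qed.

Lemma path_bij s n : bijective (path s ^~ n).
Proof.
elim: n => [|n [q pK qK]]; first by exists id.
exists (fun p => q (point_act (point_letter (inv (s n).2) p) (s n).1^-1));
  move=> p /=.
  by rewrite point_letterK point_actK pK.
by rewrite qK point_actVK point_letterVK.
Qed.

(** Cyclic reduction, by induction on the number of letters: rotate a cancelling pair of letters to
    the front and replace it by an element of [G], until the periodic word is reduced or no letter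
    remains. *)
Lemma conjugate_path n s g :
  let F p := point_act (path s p n) g in
  (exists g', conjugate_map F (point_act^~ g')) \/
  exists s' m, [/\ (0 < m)%N, forall k, s' (m + k)%N = s' k, reduced s' &
                 conjugate_map F (path s' ^~ m)].
Proof.
elim/ltn_ind: n s g => -[|n] IHn s g F.
  by left; exists g, id => //; exists id.
(* The final element g is absorbed into the first entry of each period, which amounts to conjugating
   by g. *)
pose s1 (k : nat) := let j := (k %% n.+1)%N in
  (if j == 0%N then g * (s j).1 else (s j).1, (s j).2).
have s1per k : s1 (n.+1 + k)%N = s1 k by rewrite /s1 modnDl.
have Fs1 : conjugate_map F (path s1 ^~ n.+1).
  exists (point_act^~ g^-1) => [|p].
    by exists (point_act^~ g); [exact: point_actVK | exact: point_actK].
  rewrite /F point_actK; have : (n.+1 <= n.+1)%N by [].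
  elim: {1 3 4}n => [|k IHk] kn /=.
    by rewrite /s1 mod0n /= point_actM point_actVK.
  rewrite /= in IHk; rewrite -IHk; last exact: ltnW.
  by rewrite /s1 modn_small.
have [rs1|] := pselect (reduced s1); first by right; exists s1, n.+1.
move=> /existsNP[k /contrapT[e Ck]].
pose s2 i := s1 (k + i)%N.
have Fs2 : conjugate_map F (path s2 ^~ n.+1).
  apply: conjugate_map_trans Fs1 _.
  exists (path s1 ^~ k) => [|p]; first exact: path_bij.
  rewrite -path_add addnC path_add; apply: eq_path => i _.
  by rewrite s1per.
have e0 : s2 0%N = s1 k by rewrite /s2 addn0.
have e1 : s2 1%N = s1 k.+1 by rewrite /s2 addn1.
(* With a single letter, consecutive letters coincide, so a cancellation would make a letter its own
   inverse. *)
case: n => [|n] in IHn s1 s1per F Fs1 e Ck s2 Fs2 e0 e1 *.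
  by have := inv_neq (l := (s1 k).2); rewrite -e /s1 !modn1.
(* Moving g_1 past l_1, the inverse of l_0, turns g_0 l_0 g_1 l_1 into h. *)
clearbody s2; pose h := (s2 0%N).1 * phi (s2 1%N).2 (s2 1%N).1.
pose s3 i := s2 (2 + i)%N.
have s2E p : path s2 p n.+2 = path s3 (point_act p h) n.
  rewrite -[n.+2]/(2 + n)%N path_add /=; congr (path _ _ n).
  rewrite point_letterC; last by rewrite e1.
  have e12 : (s2 1%N).2 = inv (s2 0%N).2 by rewrite e0 e1.
  by rewrite {1}e12 point_letterK -point_actM.
have Fs3 : conjugate_map F (fun p => point_act (path s3 p n) h).
  apply: conjugate_map_trans Fs2 _; exists (point_act^~ h) => [|p].
    by exists (point_act^~ h^-1); [exact: point_actK | exact: point_actVK].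
  by rewrite s2E.
have [|[g' gP]|[s' [m [m_gt0 per rs' sP]]]] := IHn n _ s3 h.
- by rewrite ltnS leqnSn.
- by left; exists g'; apply: conjugate_map_trans gP.
by right; exists s', m; split=> //; apply: conjugate_map_trans sP.
Qed.

(** * Fixed points of words *)

Lemma point_free2 p q g :
  p <> q -> point_act p g = p -> point_act q g = q -> g = 1.
Proof.
case: p q => [p vp] [q vq] pq /(congr1 sval) /= pg /(congr1 sval) /= qg.
case: p q vp vq pg qg pq => [x|p l h] [y|q k h'] vp vq /= pg qg pq;
  try by [case: pg => /(canRL (mulKg _)); rewrite mulVg
         |case: qg => /(canRL (mulKg _)); rewrite mulVg].
case: pg qg => xg [yg]; apply: (free2 _ xg yg) => xy.
by apply: pq; apply: point_inj; rewrite /= xy.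
Qed.

Lemma point_inv_free p g : g * g = 1 -> point_act p g = p -> g = 1.
Proof.
case: p => [[x|p l h] vp] g2 /(congr1 sval) /= -[]; first exact: inv_free.
by move=> /(canRL (mulKg _)); rewrite mulVg.
Qed.

Lemma conjugate_map1 F : conjugate_map F id -> F = id.
Proof. by case=> h hb hE; apply/funext => p; apply: (bij_inj hb). Qed.

(** Up to conjugacy F is either a cyclically reduced word, which has at most one fixed point, or an
    element of [G]. *)
Lemma word_map_free2 F p q :
  word_map F -> p <> q -> F p = p -> F q = q -> F = id.
Proof.
move=> /word_map_path[n [s [g FE]]] pq Fp Fq.
have := conjugate_path n s g; rewrite /= -FE.
case=> [[g' [h hb hE]]|[s' [m [m_gt0 per rs' [h hb hE]]]]]; last first.
  by case: pq; apply: (bij_inj hb); apply: (reduced_path_fix rs' m_gt0 per);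
     rewrite -hE ?Fp ?Fq.
apply: conjugate_map1; exists h => // r; rewrite hE.
suff -> : g' = 1 by rewrite point_act1.
apply: (@point_free2 (h p) (h q)); rewrite -?hE ?Fp ?Fq //.
by move/(bij_inj hb).
Qed.

Lemma word_map_inv_free F p :
  word_map F -> F \o F = id -> F p = p -> F = id.
Proof.
move=> /word_map_path[n [s [g FE]]] /funeqP F2 Fp.
have [all|/existsNP[q qp]] := pselect (forall q, q = p).
  by apply/funext => q; rewrite (all q).
have := conjugate_path n s g; rewrite /= -FE.
case=> [[g' [h hb hE]]|[s' [m [m_gt0 per rs' [h hb hE]]]]]; last first.
  (* Read twice, the reduced word is still reduced and periodic, but it fixes every point, against
     uniqueness of its fixed point. *)
  have fix2 r : path s' (h r) (m + m) = h r.
    rewrite path_add (@eq_path _ s') => [|k _]; last exact: per.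
    by rewrite -!hE; congr h; apply: F2.
  case: qp; apply: (bij_inj hb).
  apply: (reduced_path_fix rs' _ _ (fix2 q) (fix2 p)) => [|k].
    by rewrite addn_gt0 m_gt0.
  by rewrite -addnA !per.
apply: conjugate_map1; exists h => // r; rewrite hE.
have fix2 r' : point_act (h r') (g' * g') = h r'.
  by rewrite point_actM -!hE; congr h; apply: F2.
suff -> : g' = 1 by rewrite point_act1.
apply: (@point_inv_free (h p)); last by rewrite -hE Fp.
by apply: (point_free2 _ (fix2 q) (fix2 p)) => /(bij_inj hb).
Qed.

Lemma stable_letters :
  exists (G' : groupType) (X' : Type) (to' : right_action G' X') (j : X -> X'),
    [/\ injective j,
        forall g, exists g', forall x, to' (j x) g' = j (to x g),
        forall l, exists g', forall x, D l x -> to' (j x) g' = j (f l x),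
        forall x y g, x <> y -> to' x g = x -> to' y g = y -> g = 1 &
        forall x g, g * g = 1 -> to' x g = x -> g = 1].
Proof.
exists (perm_elt word_group), point, (perm_action word_group), point_of.
split=> [x y [] //|g|l|p q [F wF]|p [F wF]].
- have [a aE] := perm_actionP (P := word_group) (word_map_act g word_map_id).
  by exists a => x; rewrite [LHS](congr1 (@^~ _) aE); apply: point_inj.
- have [a aE] := perm_actionP (P := word_group) (word_map_letter l word_map_id).
  by exists a => x Dx; rewrite [LHS](congr1 (@^~ _) aE) point_of_letter.
- move=> pq /= Fp Fq; apply: perm_elt_inj => r /=.
  by rewrite (word_map_free2 wF pq Fp Fq).
move=> /(congr1 sval) /= F2 Fp; apply: perm_elt_inj => r /=.
by rewrite (word_map_inv_free wF F2 Fp).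
Qed.

End StableLetters.

(** * Moving all pairs to the base pair *)

(** The base point and its image under the involution [st_flip] form the pair to which all pairs are
    to be moved. *)
Record stage := Stage {
  st_group : groupType;
  st_type : Type;
  st_act : right_action st_group st_type;
  st_base : st_type;
  st_flip : st_group;
  st_free2 : forall x y g,
    x <> y -> st_act x g = x -> st_act y g = y -> g = 1;
  st_inv_free : forall x g, g * g = 1 -> st_act x g = x -> g = 1;
  st_flip2 : st_flip * st_flip = 1;
  st_flip_base : st_act st_base st_flip <> st_base
}.

Section Step.
Variable st : stage.
Local Notation G := (st_group st).
Local Notation X := (st_type st).
Local Notation to := (@st_act st).
Local Notation x0 := (st_base st).
Local Notation t := (st_flip st).

(** Unordered pairs are encoded by ordered ones, hence the two alternatives. *)
Definition carries (a b : X * X) (g : G) : Prop :=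
  (to a.1 g = b.1 /\ to a.2 g = b.2) \/ (to a.1 g = b.2 /\ to a.2 g = b.1).

Definition similar (a b : X * X) : Prop := exists g, carries a b g.

Lemma similar_refl a : similar a a.
Proof. by exists 1; left; rewrite !ract1. Qed.

Lemma similar_sym a b : similar a b -> similar b a.
Proof.
case=> g ab; exists g^-1; rewrite /carries.
by case: ab => -[<- <-]; [left|right]; rewrite !ractK.
Qed.

Lemma similar_trans a b c : similar a b -> similar b c -> similar a c.
Proof.
move=> [g ab] [h bc]; exists (g * h).
by case: ab bc => -[ab1 ab2] [] [bc1 bc2]; [left|right|right|left];
  rewrite !ractM ab1 ab2.
Qed.

Definition pair_rep : X * X -> X * X :=
  sval (cid (equivalence_rep similar_refl similar_sym similar_trans)).

Lemma pair_repP a : similar a (pair_rep a).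
Proof. by rewrite /pair_rep; case: cid => r [rP ?] /=; apply: rP. Qed.

Lemma pair_rep_eq a b : similar a b -> pair_rep a = pair_rep b.
Proof. by rewrite /pair_rep; case: cid => r [? rP] /=; apply: rP. Qed.

Definition target : X * X := (x0, to x0 t).

Definition selected (a : X * X) : Prop :=
  [/\ a.1 <> a.2, pair_rep a = a & ~ similar a target].

Definition swaps (a : X * X) (g : G) : Prop :=
  to a.1 g = a.2 /\ to a.2 g = a.1.

Lemma swaps_invol a g : a.1 <> a.2 -> swaps a g -> g * g = 1.
Proof.
by move=> na [a12 a21]; apply: (st_free2 na); rewrite ractM ?a12 ?a21 ?a12.
Qed.

Lemma carries_inj a g h : a.1 <> a.2 ->
  to a.1 g = to a.1 h -> to a.2 g = to a.2 h -> g = h.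
Proof.
move=> na e1 e2; apply: (mulIg h^-1); rewrite mulgV.
by apply: (st_free2 na); rewrite ractM ?e1 ?e2 ractK.
Qed.

Lemma swaps_target : swaps target t.
Proof. by split=> //=; rewrite -ractM st_flip2 ract1. Qed.

(** [(a, true)] moves a to [target] and [(a, false)] is its inverse. A pair that is not selected
    gives letters with empty domain and trivial group. *)
Definition letter : Type := (X * X) * bool.

Definition letter_inv (l : letter) : letter := (l.1, ~~ l.2).

Definition ends (l : letter) : X * X := if l.2 then l.1 else target.

Definition swapped (a : X * X) : Prop := selected a /\ exists g, swaps a g.

Definition swap (l : letter) : G :=
  if l.2 then xget 1 [set g | swaps l.1 g] else t.

(** The groups at both ends must be isomorphic: if nothing swaps a, the one at [target] is trivial
    too, although [t] swaps [target]. *)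
Definition letter_grp (l : letter) : set G :=
  [set c | c = 1 \/ swapped l.1 /\ c = swap l].

Definition letter_iso (l : letter) (c : G) : G :=
  if pselect (c = 1) then 1 else swap (letter_inv l).

Definition letter_dom (l : letter) : set X :=
  [set x | selected l.1 /\ (x = (ends l).1 \/ x = (ends l).2)].

Definition letter_map (l : letter) (x : X) : X :=
  if pselect (x = (ends l).1) then (ends (letter_inv l)).1
  else (ends (letter_inv l)).2.

Lemma letter_invK : involutive letter_inv.
Proof. by case=> a b; rewrite /letter_inv /= negbK. Qed.

Lemma letter_inv_neq l : letter_inv l <> l.
Proof. by case: l => a []. Qed.

Lemma ends_neq l : selected l.1 -> (ends l).1 <> (ends l).2.
Proof.
case=> na _ _; rewrite /ends; case: l.2 => //= e.
by case: (@st_flip_base st).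
Qed.

Lemma swaps_swap l : swapped l.1 -> swaps (ends l) (swap l).
Proof.
case=> _ [g ag]; rewrite /ends /swap; case: l.2; last exact: swaps_target.
exact: (xgetI 1 ag).
Qed.

Lemma swap_invol l : swapped l.1 -> swap l * swap l = 1.
Proof.
by move=> sl; apply/(swaps_invol _ (swaps_swap sl))/ends_neq; case: sl.
Qed.

Lemma swap_neq1 l : swapped l.1 -> swap l <> 1.
Proof.
move=> sl e; have [] := swaps_swap sl; rewrite e !ract1 => /ends_neq + _.
by apply; case: sl.
Qed.

Lemma letter_iso1 l : letter_iso l 1 = 1.
Proof. by rewrite /letter_iso; case: pselect. Qed.

Lemma letter_iso_swap l : swapped l.1 ->
  letter_iso l (swap l) = swap (letter_inv l).
Proof. by move=> /swap_neq1; rewrite /letter_iso; case: pselect. Qed.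

Lemma letter_map1 l : letter_map l (ends l).1 = (ends (letter_inv l)).1.
Proof. by rewrite /letter_map; case: pselect. Qed.

Lemma letter_map2 l : selected l.1 ->
  letter_map l (ends l).2 = (ends (letter_inv l)).2.
Proof.
by move=> /ends_neq nl; rewrite /letter_map; case: pselect => //= e; case: nl.
Qed.

Lemma letter_grp1 l : letter_grp l 1. Proof. by left. Qed.

Lemma letter_grpM l c d :
  letter_grp l c -> letter_grp l d -> letter_grp l (c * d).
Proof.
case=> [->|[sl ->]]; first by rewrite mul1g.
case=> [->|[_ ->]]; first by rewrite mulg1; right.
by left; rewrite swap_invol.
Qed.

Lemma letter_grpV l c : letter_grp l c -> letter_grp l c^-1.
Proof.
case=> [->|[sl ->]]; first by left; rewrite invg1.
right; split=> //; apply: (mulIg (swap l)).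
by rewrite mulVg swap_invol.
Qed.

Lemma letter_isoC l c : letter_grp l c ->
  letter_grp (letter_inv l) (letter_iso l c).
Proof.
by case=> [->|[sl ->]]; rewrite ?letter_iso1 ?letter_iso_swap //; [left|right].
Qed.

Lemma letter_isoK l c : letter_grp l c ->
  letter_iso (letter_inv l) (letter_iso l c) = c.
Proof.
by case=> [->|[sl ->]]; rewrite ?letter_iso1 ?letter_iso_swap ?letter_invK.
Qed.

Lemma letter_isoM l c d : letter_grp l c -> letter_grp l d ->
  letter_iso l (c * d) = letter_iso l c * letter_iso l d.
Proof.
case=> [->|[sl ->]]; first by rewrite letter_iso1 !mul1g.
case=> [->|[_ ->]]; first by rewrite letter_iso1 !mulg1.
by rewrite swap_invol // letter_iso1 letter_iso_swap // swap_invol.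
Qed.

Lemma letter_domC l x c :
  letter_grp l c -> letter_dom l x -> letter_dom l (to x c).
Proof.
case=> [->|[sl ->]]; first by rewrite ract1.
have [s1 s2] := swaps_swap sl.
by case=> ? [->|->]; split=> //; rewrite ?s1 ?s2; [right|left].
Qed.

Lemma letter_mapD l x :
  letter_dom l x -> letter_dom (letter_inv l) (letter_map l x).
Proof.
by case=> sl [->|->]; rewrite ?letter_map1 ?letter_map2 //; split=> //;
  [left|right].
Qed.

Lemma letter_mapK l x :
  letter_dom l x -> letter_map (letter_inv l) (letter_map l x) = x.
Proof.
by case=> sl [->|->]; rewrite ?letter_map1 ?letter_map2 // letter_invK.
Qed.

Lemma letter_mapC l x c : letter_grp l c -> letter_dom l x ->
  letter_map l (to x c) = to (letter_map l x) (letter_iso l c).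
Proof.
case=> [->|[sl ->]]; first by rewrite letter_iso1 !ract1.
have [s1 s2] := swaps_swap sl.
have [r1 r2] := @swaps_swap (letter_inv l) sl.
rewrite letter_iso_swap //.
by case=> ? [->|->];
  rewrite ?s1 ?s2 ?letter_map1 ?letter_map2 // ?letter_map1 ?r1 ?r2.
Qed.

Lemma letter_free l x c :
  letter_grp l c -> ~ letter_dom l x -> to x c = x -> c = 1.
Proof. by case=> [->//|[sl ->]] _; apply/st_inv_free/swap_invol. Qed.

(** An element preserving the pair fixes both points, so is 1, or exchanges them and so agrees with
    [swap] at both. Hence at the end a, [letter_grp] is the full setwise stabiliser. *)
Lemma letter_grpP (a : X * X) g :
  selected a -> carries a a g -> letter_grp (a, true) g.
Proof.
move=> sa; have [na _ _] := sa; case=> [[a1 a2]|[a12 a21]].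
  by left; apply: (st_free2 na).
have sw : swapped a by split=> //; exists g.
right; split=> //; have [s1 s2] := @swaps_swap (a, true) sw.
by apply: (@carries_inj a) => //=; rewrite ?a12 ?a21.
Qed.

Lemma step_reduced_fix (s : nat -> G * letter) (x y : nat -> X) :
  reduced letter_inv letter_grp s ->
  (forall k, letter_dom (s k).2 (to (x k) (s k).1) /\
             x k.+1 = letter_map (s k).2 (to (x k) (s k).1)) ->
  (forall k, letter_dom (s k).2 (to (y k) (s k).1) /\
             y k.+1 = letter_map (s k).2 (to (y k) (s k).1)) ->
  x 0%N = y 0%N.
Proof.
move=> rs xP yP; apply: contrapT => xy0.
(* Letters are injective on their domains, so the two points stay distinct and always occupy both
   ends of a letter. *)
have neq k : x k <> y k.
  elim: k => [//|k IHk] e; apply: IHk.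
  have [[Dx ex] [Dy ey]] := (xP k, yP k); move: e; rewrite ex ey.
  move/(congr1 (letter_map (letter_inv (s k).2))); rewrite !letter_mapK // => e.
  exact: ract_inj e.
have sel k : selected (s k).2.1 by have [[]] := xP k.
have step k : carries (ends (letter_inv (s k).2)) (ends (s k.+1).2) (s k.+1).1.
  have [[_ xk] ex] := xP k; have [[_ yk] ey] := yP k.
  have [[_ xk1] _] := xP k.+1; have [[_ yk1] _] := yP k.+1.
  have nk m : to (x m) (s m).1 <> to (y m) (s m).1.
    by move=> e; apply: (neq _ (ract_inj e)).
  have := nk k; have nk1 := nk k.+1; move=> {}nk.
  rewrite /carries; case: xk yk ex ey nk => -> [] ->;
    rewrite ?letter_map1 ?letter_map2 // => ex ey // _;
    rewrite ex ey in nk1 xk1 yk1;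
    case: xk1 yk1 nk1 => -> [] -> // _; by [left | right].
(* Two consecutive letters marked [true] would put a selected pair in the orbit of [target]. *)
have alt k : (s k).2.2 = true -> (s k.+1).2.2 = false.
  move=> sk; apply/negP => sk1; have := step k.
  rewrite /ends /= sk sk1 /= => /(ex_intro _ _)/similar_sym.
  by have [] := sel k.+1.
(* After a letter marked [false], another such letter would again make a selected pair similar to
   [target], while one marked [true] belongs to the same representative and cancels. *)
have nofalse k : (s k).2.2 = true.
  apply: contrapT => /negP/negbTE sk; have := step k; rewrite {1}/ends /= sk /=.
  rewrite /ends; case sk1 : (s k.+1).2.2 => st'; last first.
    by have [_ _] := sel k; apply; exists (s k.+1).1.
  have e : (s k).2.1 = (s k.+1).2.1.
    have [_ <- _] := sel k; have [_ <- _] := sel k.+1.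
    by apply: pair_rep_eq; exists (s k.+1).1.
  apply: (rs k); rewrite [(s k.+1).2]surjective_pairing sk1 -e; split.
    by rewrite /letter_inv sk.
  by apply: letter_grpP => //; rewrite {2}e.
by have := alt 0%N (nofalse _); rewrite nofalse.
Qed.

End Step.

(** Elements are lifted one at a time; that lifting respects products is recovered at the end, from
    the triviality of elements fixing two points. *)
Record extension (s s' : stage) (j : st_type s -> st_type s') : Prop :=
Extension {
  ext_inj : injective j;
  ext_act : forall g, exists g', forall x,
    st_act s' (j x) g' = j (st_act s x g);
  ext_base : j (st_base s) = st_base s';
  ext_trans : forall x y, x <> y -> exists g',
    st_act s' (j x) g' = st_base s' /\
    st_act s' (j y) g' = st_act s' (st_base s') (st_flip s')
}.

Lemma extension_exists (s : stage) :
  exists (s' : stage) (j : st_type s -> st_type s'), extension j.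
Proof.
have [G' [X' [to' [j [j_inj j_act j_letter free2 inv_free]]]]] :=
  (* The first argument only has to be some letter. *)
  stable_letters (target s, true) (@letter_invK s) (@letter_inv_neq s)
  (@letter_grp1 s) (@letter_grpM s) (@letter_grpV s) (@letter_isoC s)
  (@letter_isoK s) (@letter_isoM s) (@letter_domC s) (@letter_mapD s)
  (@letter_mapK s) (@letter_mapC s) (@letter_free s) (@st_free2 s)
  (@st_inv_free s) (@step_reduced_fix s).
have [t' t'E] := j_act (st_flip s).
have t'2 : t' * t' = 1.
  have t'fix x : to' (j x) (t' * t') = j x.
    by rewrite ractM !t'E -ractM st_flip2 ract1.
  apply: (free2 _ _ _ _ (t'fix (st_base s)) (t'fix _)) => /j_inj.
  exact/nesym/st_flip_base.
have t'b : to' (j (st_base s)) t' <> j (st_base s).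
  by rewrite t'E => /j_inj/st_flip_base.
exists (Stage free2 inv_free t'2 t'b), j; split=> //= x y xy.
(* For pairs in the orbit of [target] the old group suffices, with t' correcting the order if
   necessary. *)
have hit a b g : carries (a, b) (target s) g -> exists g',
    to' (j a) g' = j (st_base s) /\ to' (j b) g' = to' (j (st_base s)) t'.
  have [g' g'E] := j_act g; case=> /= -[ag bg].
    by exists g'; rewrite !g'E ag bg t'E.
  exists (g' * t'); rewrite !ractM !g'E ag bg -t'E; split=> //.
  by rewrite -ractM t'2 ract1.
set a := pair_rep (x, y); have [g xyg] : similar (x, y) a by apply: pair_repP.
have [sa|nsa] := pselect (similar a (target s)).
  by have [h /hit] := similar_trans (ex_intro _ g xyg) sa.
have a_neq : a.1 <> a.2.
  by case: xyg => /= -[<- <-] e; apply: xy; move: (ract_inj e).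
have sel : selected a.
  by split=> //; rewrite -(@pair_rep_eq _ (x, y) a) //; exists g.
have [h hE] := j_letter (a, true); have [g' g'E] := j_act g.
have h1 : to' (j a.1) h = j (st_base s).
  by rewrite hE ?(letter_map1 (a, true)) //; split=> //; left.
have h2 : to' (j a.2) h = to' (j (st_base s)) t'.
  by rewrite hE ?(@letter_map2 _ (a, true)) ?t'E //; split=> //; right.
case: xyg => /= -[xg yg].
  by exists (g' * h); rewrite !ractM !g'E xg yg.
exists (g' * h * t'); rewrite !ractM !g'E xg yg h1 h2; split=> //.
by rewrite -ractM t'2 ract1.
Qed.

(** * Countable limits *)

Section Colimit.
Variables (T : nat -> Type) (e : forall n, T n -> T n.+1).
Hypothesis e_inj : forall n, injective (e (n := n)).

(* The colimit is realised by the elements [existT n x] with [x] not in the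
   image of [e]; [colim_in] pulls an element back as far as possible. *)
Fixpoint colim_in (n : nat) : T n -> {n : nat & T n} :=
  match n with
  | 0 => existT T 0
  | m.+1 => fun x =>
      match pselect (exists y, e y = x) with
      | left ex => colim_in (sval (cid ex))
      | right _ => existT T m.+1 x
      end
  end.

Lemma colim_inS n (x : T n) : colim_in (e x) = colim_in x.
Proof.
rewrite /=; case: pselect => [ex|[]]; last by exists x.
by case: cid => y /= /e_inj ->.
Qed.

Lemma colim_in_tag n (x : T n) : (tag (colim_in x) <= n)%N.
Proof.
elim: n x => // n IHn x /=; case: pselect => //= ex.
exact: leq_trans (IHn _) (leqnSn n).
Qed.

(** At level n + 1, an element outside the image of [e] keeps the tag n + 1, whereas one that is
    pulled back has a tag of at most n. *)
Lemma colim_in_inj n : injective (colim_in (n := n)).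
Proof.
have pair2 m (x y : T m) : existT T m x = existT T m y -> x = y.
  exact: (Eqdep_dec.inj_pair2_eq_dec _ (@eq_comparable _)).
elim: n => [x y /pair2//|n IHn x y] /=.
case: pselect => [ex|_]; case: pselect => [ey|_]; last exact: pair2.
- case: cid => x' /= <-; case: cid => y' /= <-.
  by move/IHn ->.
- by move=> exy; have := colim_in_tag (sval (cid ex)); rewrite exy /= ltnn.
by move=> exy; have := colim_in_tag (sval (cid ey)); rewrite -exy /= ltnn.
Qed.

Lemma colimit : exists (Y : Type) (i : forall n, T n -> Y),
  [/\ forall n, injective (i n), forall n x, i n.+1 (e x) = i n x &
      forall y, exists n x, i n x = y].
Proof.
exists {y | exists n (x : T n), colim_in x = y}.
exists (fun n x => exist _ (colim_in x) (ex_intro _ n (ex_intro _ x erefl))).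
split=> [n x y [] /colim_in_inj//|n x|[y [n [x xy]]]].
  by apply: eq_exist; apply: colim_inS.
by exists n, x; apply: eq_exist.
Qed.

End Colimit.

Section ColimitMap.
Variables (T : nat -> Type) (e : forall n, T n -> T n.+1).
Variables (Y : Type) (i : forall n, T n -> Y).
Hypothesis i_inj : forall n, injective (i (n := n)).
Hypothesis iS : forall n (x : T n), i (e x) = i x.
Hypothesis i_surj : forall y, exists n (x : T n), i x = y.

Lemma colimit_level y :
  exists n0, forall n, (n0 <= n)%N -> exists x : T n, i x = y.
Proof.
have [n0 [x <-]] := i_surj y; exists n0; elim=> [|n IHn].
  by rewrite leqn0 => /eqP e0; move: x; rewrite e0 => x; exists x.
rewrite leq_eqVlt ltnS => /orP[/eqP e0|/IHn[z <-]].
  by move: x {IHn}; rewrite e0 => x; exists x.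
by exists (e z); rewrite iS.
Qed.

(** The value at a point is read off at some level from N on; [up] compares two readings at a common
    higher level. *)
Lemma colimit_map (f : forall n, T n -> T n) N :
  (forall n, (N <= n)%N -> forall x : T n, f n.+1 (e x) = e (f n x)) ->
  exists F : Y -> Y,
    forall n, (N <= n)%N -> forall x : T n, F (i x) = i (f n x).
Proof.
move=> fe.
have up m n (x : T m) : (N <= m)%N -> (m <= n)%N ->
    exists z : T n, i z = i x /\ i (f n z) = i (f m x).
  move=> Nm; elim: n => [|n IHn].
    by rewrite leqn0 => /eqP m0; move: x; rewrite m0 => x; exists x.
  rewrite leq_eqVlt ltnS => /orP[/eqP m0|mn].
    by move: x {IHn}; rewrite m0 => x; exists x.
  have [z [iz ifz]] := IHn mn; exists (e z).
  by rewrite fe ?(leq_trans Nm) // !iS.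
have /choice[F FP] : forall y, exists y', exists n (x : T n),
    [/\ (N <= n)%N, i x = y & i (f n x) = y'].
  move=> y; have [n0 /(_ (maxn N n0) (leq_maxr _ _))[x ix]] := colimit_level y.
  by exists (i (f _ x)), (maxn N n0), x; rewrite leq_maxl.
exists F => n Nn x; have [m [z [Nm iz <-]]] := FP (i x).
have [z1 [iz1 <-]] := up m (maxn m n) z Nm (leq_maxl _ _).
have [x1 [ix1 <-]] := up n (maxn m n) x Nn (leq_maxr _ _).
by congr (i (f _ _)); apply: i_inj; rewrite iz1 ix1.
Qed.

End ColimitMap.

(** Dependent choice started at level N, with [d] filling the levels below; the induction on N
    shifts the family [T]. *)
Lemma dependent_sequence (T : nat -> Type) (R : forall n, T n -> T n.+1 -> Prop)
    (d : forall n, T n) N (x : T N) :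
  (forall n (y : T n), exists z, R n y z) ->
  exists s : forall n, T n,
    s N = x /\ forall n, (N <= n)%N -> R n (s n) (s n.+1).
Proof.
elim: N T R d x => [|N IHN] T R d x tot.
  pose next n (y : T n) := sval (cid (tot n y)).
  exists (nat_rect T x next); split=> // n _ /=.
  by rewrite /next; case: cid.
have [s [sN sR]] :=
  IHN (T \o succn) (fun n => R n.+1) (fun n => d n.+1) x (fun n => tot n.+1).
exists (fun n => match n with 0 => d 0%N | m.+1 => s m end); split=> // -[//|n].
exact: sR.
Qed.

Section Limit.
Variables (S : nat -> stage).
Variable e : forall n, st_type (S n) -> st_type (S n.+1).
Hypothesis eP : forall n, extension (e (n := n)).
Local Notation T := (fun n => st_type (S n)).
Local Notation G := (fun n => st_group (S n)).
Local Notation to n := (st_act (S n)).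

Lemma limit_stage :
  exists (G : groupType) (Y : Type) (to : right_action G Y)
         (i : st_type (S 0) -> Y),
    [/\ injective i,
        forall g, exists g', forall x, to (i x) g' = i (st_act (S 0) x g),
        forall x y x' y', x <> y -> x' <> y' ->
          exists g, to x g = x' /\ to y g = y',
        forall x y g, x <> y -> to x g = x -> to y g = y -> g = 1 &
        forall x g, g * g = 1 -> to x g = x -> g = 1].
Proof.
have e_inj n : injective (@e n) := ext_inj (@eP n).
have [Y [i [i_inj iS i_surj]]] := colimit e_inj.
have level := colimit_level iS i_surj.
(* The limit group consists of the maps that act, on every level from some N on, as an element of
   the group of that level. *)
pose P (F : Y -> Y) := exists N, forall n, (N <= n)%N ->
  exists g : st_group (S n), forall x, F (i n x) = i n (to n x g).
have P1 : P id by exists 0%N => n _; exists 1 => x; rewrite ract1.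
have PM F F' : P F -> P F' -> P (F' \o F).
  move=> [N FP] [N' FP']; exists (maxn N N') => n.
  rewrite geq_max => /andP[Nn N'n].
  have [[g gP] [g' gP']] := (FP n Nn, FP' n N'n).
  by exists (g * g') => x /=; rewrite gP gP' ractM.
have PV F : P F -> exists2 F', P F' & cancel F F' /\ cancel F' F.
  move=> [N FP].
  have F_inj : injective F.
    move=> y z; have [[m my] [k kz]] := (level y, level z).
    pose n := maxn N (maxn m k); have Nn : (N <= n)%N by rewrite leq_maxl.
    have [x <-] : exists x, i n x = y by apply: my; rewrite !leq_max leqnn orbT.
    have [x' <-] : exists x, i n x = z.
      by apply: kz; rewrite !leq_max leqnn !orbT.
    have [g gP] := FP n Nn; rewrite !gP => /i_inj xx'.
    by rewrite (ract_inj xx').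
  have /choice[F' F'K] : forall y, exists y', F y' = y.
    move=> y; have [m my] := level y.
    have [x <-] := my _ (leq_maxr N m); have [g gP] := FP _ (leq_maxl N m).
    by exists (i _ (to _ x g^-1)); rewrite gP ractVK.
  exists F'; last by split=> // y; apply: F_inj.
  exists N => n Nn; have [g gP] := FP n Nn; exists g^-1 => x.
  by apply: F_inj; rewrite F'K gP ractVK.
pose Q := PermGroup P1 PM PV.
have lift N (g : st_group (S N)) : exists a : perm_elt Q, forall x,
    perm_action Q (i N x) a = i N (to N x g).
  (* Successive lifts of g form a compatible sequence, which defines a map on the colimit. *)
  have [s [sN sR]] := @dependent_sequence G
    (fun n h h' => forall x, to n.+1 (e x) h' = e (to n x h))
    (fun=> 1) N g (fun n => ext_act (@eP n)).
  have [F FP] := colimit_map i_inj iS i_surj (f := fun n x => to n x (s n)) sR.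
  have PF : P F by exists N => n Nn; exists (s n) => x; apply: FP.
  by exists (exist _ F PF) => x /=; rewrite FP // sN.
have trans (y z : Y) : y <> z -> exists n0, forall n, (n0 <= n)%N ->
    exists a : perm_elt Q, perm_action Q y a = i n.+1 (st_base (S n.+1)) /\
      perm_action Q z a =
        i n.+1 (to n.+1 (st_base (S n.+1)) (st_flip (S n.+1))).
  move=> yz; have [[m my] [k kz]] := (level y, level z).
  exists (maxn m k) => n; rewrite geq_max => /andP[mn kn].
  have [[y' y'E] [z' z'E]] := (my n mn, kz n kn).
  have [|g [g1 g2]] := ext_trans (@eP n) (x := y') (y := z').
    by move=> yz'; apply: yz; rewrite -y'E -z'E yz'.
  have [a aP] := lift n.+1 g; exists a.
  by rewrite -y'E -z'E -(iS _ y') -(iS _ z') !aP g1 g2.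
have free n (F : Y -> Y) (g : st_group (S n)) :
    (forall x, F (i n x) = i n (to n x g)) -> g = 1 ->
    forall x, F (i n x) = i n x.
  by move=> FP g1 x; rewrite FP g1 ract1.
have global (F : Y -> Y) N : 
  (forall n, (N <= n)%N -> forall x, F (i n x) = i n x) -> F = id.
  move=> FP; apply/funext => y; have [m my] := level y.
  by have [x <-] := my _ (leq_maxr N m); rewrite FP ?leq_maxl.
exists (perm_elt Q), Y, (perm_action Q), (i 0%N); split=> //.
- move=> y z y' z' yz yz'.
  have [[m mP] [m' mP']] := (trans y z yz, trans y' z' yz').
  (* Both pairs are moved to the base pair of the same level; a followed by the inverse of b then
     links them. *)
  have [a [a1 a2]] := mP _ (leq_maxl m m').
  have [b [b1 b2]] := mP' _ (leq_maxr m m').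
  by exists (a * b^-1); rewrite !ractM a1 a2 -b1 -b2 !ractK.
- move=> y z [F PF] yz /= Fy Fz; apply: perm_elt_inj => /= r; rewrite /=.
  have [N FP] := PF; have [[m my] [k kz]] := (level y, level z).
  rewrite (@global F (maxn N (maxn m k))) // => n.
  rewrite !geq_max => /and3P[Nn mn kn].
  have [[y' y'E] [z' z'E]] := (my n mn, kz n kn); have [g gP] := FP n Nn.
  apply: (free n F g gP); apply: (@st_free2 (S n) y' z').
  + by move=> yz'; apply: yz; rewrite -y'E -z'E yz'.
  + by apply: (i_inj n); rewrite -[LHS]gP y'E.
  by apply: (i_inj n); rewrite -[LHS]gP z'E.
move=> y [F PF] /(congr1 sval)/funeqP /= F2 Fy; apply: perm_elt_inj => /= r.
have [N FP] := PF; have [m my] := level y.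
rewrite (@global F (maxn N m)) // => n; rewrite geq_max => /andP[Nn mn].
have [y' y'E] := my n mn; have [g gP] := FP n Nn.
apply: (free n F g gP); apply: (@st_inv_free (S n) y'); last first.
  by apply: (i_inj n); rewrite -[LHS]gP y'E.
(* The square of g fixes the whole level, in particular the base point and its distinct flip, so it
   is 1. *)
have fixgg x : to n x (g * g) = x.
  by apply: (i_inj n); rewrite ractM -gP -gP; apply: F2.
apply: (st_free2 _ (fixgg _) (fixgg _)); exact: st_flip_base.
Qed.

End Limit.

(** * The tower of extensions *)

Definition next_stage (s : stage) : stage := sval (cid (extension_exists s)).

Definition next_map (s : stage) : st_type s -> st_type (next_stage s) :=
  sval (cid (svalP (cid (extension_exists s)))).

Lemma next_mapP s : extension (@next_map s).
Proof. exact: svalP (cid (svalP (cid (extension_exists s)))). Qed.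

Fixpoint tower (s0 : stage) (n : nat) : stage :=
  if n is m.+1 then next_stage (tower s0 m) else s0.

Definition tower_limit (s0 : stage) :=
  limit_stage (fun n => next_mapP (tower s0 n)).

(** * Abelian normal subgroups *)

Section NoAbelianNormal.
Variables (G : groupType) (Y : Type) (to : right_action G Y).
Hypothesis trans2 : forall x y x' y', x <> y -> x' <> y' ->
  exists g, to x g = x' /\ to y g = y'.
Hypothesis free2 : forall x y g, x <> y -> to x g = x -> to y g = y -> g = 1.
Hypothesis inv_free : forall x g, g * g = 1 -> to x g = x -> g = 1.

(* [N] is regular; if [m] in [N] agrees with the involution [a] at [y], then
   [m ^ a] and [m^-1] agree at [y a], so [m * a] is an involution fixing [y]. *)
Lemma involution_mem (N : set G) (y0 y1 : Y) (a : G) :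
  y0 <> y1 -> is_normal_subgroup N -> is_abelian N -> N <> [set 1] ->
  a * a = 1 -> N a.
Proof.
move=> y01 [[/set_mem N1 NB] NJ] Nab Nn1 a2.
have {}NB x y : N x -> N y -> N (x / y).
  by move=> /mem_set Nx /mem_set Ny; apply/set_mem/NB.
have NV x : N x -> N x^-1 by move/(NB _ _ N1); rewrite mul1g.
have NM x y : N x -> N y -> N (x * y).
  by move=> Nx /NV/(NB _ _ Nx); rewrite invgK.
have [->//|a1] := eqVneq a 1.
have [n [Nn n1]] : exists n, N n /\ n <> 1.
  apply: contrapT => none; apply: Nn1; apply/seteqP; split=> [n Nn|_ -> //].
  by apply: contrapT => n1; apply: none; exists n.
have [y yn] : exists y, to y n <> y.
  apply: contrapT => none; apply: n1; apply: (free2 y01);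
    by apply: contrapT => yn; apply: none; eexists; exact: yn.
(* Conjugating n by an element that fixes y and takes y n to u gives the required member of [N]. *)
have Ntrans u : u <> y -> exists2 m, N m & to y m = u.
  move=> uy; have [g [yg yng]] := trans2 (nesym yn) (nesym uy).
  exists (n ^ g); first exact: NJ.
  by rewrite /conjg !ractM -{1}yg ractK yng.
(* As [N] is abelian and transitive, a member fixing x also fixes every translate of x by [N], hence
   a second point. *)
have Nfree m x : N m -> to x m = x -> m = 1.
  move=> Nm xm; have [z zx] : exists z, z <> x.
    have [e|] := pselect (y0 = x); last by exists y0.
    by exists y1; rewrite -e; apply: nesym.
  suff [k Nk xk] : exists2 k, N k & to x k = z.
    by apply: (free2 (nesym zx) xm); rewrite -xk -ractM (Nab k m) // ractM xm.
  have to_y u : exists2 k, N k & to y k = u.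
    have [->|] := pselect (u = y); last exact: Ntrans.
    by exists 1; rewrite ?ract1.
  have [[k1 Nk1 k1E] [k2 Nk2 k2E]] := (to_y x, to_y z).
  by exists (k1^-1 * k2); [exact/NM/Nk2/NV | rewrite ractM -k1E ractK k2E].
have ya : to y a <> y by move/(inv_free a2)/eqP; apply/negP.
have [m Nm ym] := Ntrans _ ya.
have aV : a^-1 = a by apply: (mulIg a); rewrite mulVg a2.
have mma : m * m ^ a = 1.
  apply: (Nfree _ y); first exact/NM/NJ.
  by rewrite /conjg aV !ractM ym -(ractM to y a a) a2 ract1 ym -ractM a2 ract1.
suff ma : m * a = 1 by rewrite (_ : a = m) //; apply: (mulIg a); rewrite ma a2.
apply: (inv_free _ (x := y)); last by rewrite ractM ym -ractM a2 ract1.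
by rewrite -mma /conjg aV !mulgA.
Qed.

End NoAbelianNormal.

(** * From the regular action to the theorem *)

Lemma regular_free (K : groupType) (x g : K) : x * g = x -> g = 1.
Proof. by move/(canRL (mulKg x)); rewrite mulVg. Qed.

Lemma embed_2_transitive (K : groupType) (t : K) : t * t = 1 -> t <> 1 ->
  exists (G : groupType) (k : {multiplicative K -> G})
         (Y : Type) (to : right_action G Y),
    [/\ injective k, exists y z : Y, y <> z,
        forall x y x' y', x <> y -> x' <> y' ->
          exists g, to x g = x' /\ to y g = y',
        forall x y g, x <> y -> to x g = x -> to y g = y -> g = 1 &
        forall x g, g * g = 1 -> to x g = x -> g = 1].
Proof.
move=> t2 t1; pose r : right_action K K := RightAction (@mulg1 K) (@mulgA K).
have r_free2 x y g : x <> y -> r x g = x -> r y g = y -> g = 1.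
  by move=> _ /regular_free.
have r_inv_free x g : g * g = 1 -> r x g = x -> g = 1 by move=> _ /regular_free.
have r_base : r 1 t <> 1 by rewrite /= mul1g.
have [G [Y [to [j [j_inj lift trans free2 inv_free]]]]] :=
  tower_limit (Stage r_free2 r_inv_free t2 r_base).
have /choice[k kP] := lift.
have kM : {morph k : g h / g * h}.
  (* Both sides agree on the image of [j], which contains two distinct points, the images of 1 and
     t. *)
  move=> g h; have fixed x : to (j x) (k (g * h) * (k g * k h)^-1) = j x.
    have e : to (j x) (k g * k h) = to (j x) (k (g * h)).
      by rewrite ractM !kP /= mulgA.
    by rewrite ractM -e ractK.
  apply: (mulIg (k g * k h)^-1); rewrite mulgV.
  by apply: (free2 _ _ _ _ (fixed 1) (fixed t)) => /j_inj/esym.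
pose kH := isMultiplicative.Build K G k kM.
exists G, (HB.pack_for {multiplicative K -> G} k kH), Y, to.
split=> //; last first.
  by exists (j 1), (j t) => /j_inj/esym.
move=> g h /= kgh; have := kP g 1; rewrite kgh kP => /j_inj /=.
by rewrite !mul1g.
Qed.

Theorem corollary2p2 (H : groupType) :
  exists (G : groupType) (i : {multiplicative H -> G})
         (Y : Type) (to : right_action G Y),
    [/\ injective i,
        sharply_2_transitive to
      & ~ exists N : set G,
            [/\ is_normal_subgroup N, is_abelian N & N <> [set 1]]].
Proof.
(* The factor ['S_3] supplies two involutions, (0 1) and (0 2), that do not commute. *)
pose t (k : 'I_3) : H * 'S_3 := (1, tperm ord0 k).
have t2 k : t k * t k = 1 by congr pair; [exact: mulg1 | exact: tperm2].
pose k1 : 'I_3 := Ordinal (isT : 1 < 3)%N.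
pose k2 : 'I_3 := Ordinal (isT : 2 < 3)%N.
have t1 : t k1 <> 1.
  by case=> /permP/(_ ord0); rewrite tpermL perm1.
have [G [k [Y [to [k_inj [y [z yz]] trans free2 inv_free]]]]] :=
  embed_2_transitive (t2 k1) t1.
have iM : {morph (fun h : H => k (h, 1)) : g h / g * h}.
  by move=> g h; rewrite -gmulfM; congr (k (_, _)); rewrite mulg1.
pose iH := isMultiplicative.Build H G _ iM.
pose i := HB.pack_for {multiplicative H -> G} (fun h : H => k (h, 1)) iH.
exists G, i, Y, to.
split.
- by move=> g h /= /k_inj[].
- split=> [|x y' x' y'' xy xy']; first by exists y, z.
  have [g [gx gy]] := trans _ _ _ _ xy xy'; exists g; split=> // h [hx hy].
  apply: (mulIg h^-1); rewrite mulgV; apply: (free2 _ _ _ xy).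
    by rewrite ractM gx -hx ractK.
  by rewrite ractM gy -hy ractK.
case=> N [nN abN N1].
have kN a : N (k (t a)).
  apply: (involution_mem trans free2 inv_free yz nN abN N1).
  by rewrite -gmulfM t2; apply: (mulIg (k 1)); rewrite -gmulfM !mul1g.
have := abN _ _ (kN k1) (kN k2).
rewrite /commute -!gmulfM => /k_inj/(congr1 snd).
(* The two products of the transpositions send 0 to 1 and to 2 respectively. *)
by move/permP/(_ ord0); rewrite !permM !tpermL !tpermD // => /(congr1 val).
Qed.
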